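(* Suppose the cost functions $C_j:\mathbb{R}\to\mathbb{R}$ ($j\in G$) and $C_{dj}:\mathbb{R}\to\mathbb{R}$ ($j\in N$) are continuously differentiable and strictly convex. Suppose the control dynamics (S1) and (S2) of the context are chosen such that, for all $\zeta_j$, $$k_{p^M_j}(\zeta_j) = \big[(C_j')^{-1}(f(\zeta_j))\big]^{p^{M,max}_j}_{p^{M,min}_j}\ (j\in G),\qquad k_{d^c_j}(\zeta_j) = \big[(C_{dj}')^{-1}(-f(\zeta_j))\big]^{d^{c,max}_j}_{d^{c,min}_j}\ (j\in N),$$ for some surjective function $f:\mathbb{R}^2\to\mathbb{R}$ (the same for all buses) which is strictly increasing with respect to its second argument $p^c_j$. Then, for any equilibrium of the system (N1)--(N4), (S1)--(S3), (P1)--(P2), the equilibrium values $p^{M,*}=(p^{M,*}_j)_{j\in G}$ and $d^{c,*}=(d^{c,*}_j)_{j\in N}$ are optimal for the OSLC problem.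
   Context: Notation. $[q]_a^b=\max\{\min\{q,b\},a\}$ for $a\le b$. Input/output subsystems. A subsystem is $\dot x=F(x,u)$, $y=g(x,u)$ with $u\in\mathbb{R}^m$, $x\in\mathbb{R}^n$, $y\in\mathbb{R}^k$, $F$ locally Lipschitz, $g$ continuous. For the subsystems (S1)--(S3) below it is assumed that for each constant input $\bar u$ there is a unique equilibrium $\bar x$ ($F(\bar x,\bar u)=0$), which is locally asymptotically stable. Put $k_x(\bar u)=\bar x$; the static input-output map is $k_y(\bar u)=g(k_x(\bar u),\bar u)$. Network. $(N,E)$ is a connected graph, $N$ the finite set of buses and $E\subseteq N\times N$ the set of lines, arbitrarily directed (if $(i,j)\in E$ then $(j,i)\notin E$). $N$ is the disjoint union of $G$ (buses with inertia) and $L$ (buses without inertia). Constants: $M_j>0$ ($j\in G$), $B_{ij}>0$ and $p^{nom}_{ij}\in\mathbb{R}$ ($(i,j)\in E$), $p^L_j\in\mathbb{R}$ ($j\in N$). Dynamics: (N1) $\dot\eta_{ij}=\omega_i-\omega_j$, $(i,j)\in E$ (with $\eta_{ij}=\theta_i-\theta_j$ for bus angles $\theta_j$, $\dot\theta_j=\omega_j$); (N2) $M_j\dot\omega_j=-p^L_j+p^M_j-(d^c_j+d^u_j)-\sum_{k:(j,k)\in E}p_{jk}+\sum_{i:(i,j)\in E}p_{ij}$, $j\in G$; (N3) $0=-p^L_j-(d^c_j+d^u_j)-\sum_{k:(j,k)\in E}p_{jk}+\sum_{i:(i,j)\in E}p_{ij}$, $j\in L$; (N4) $p_{ij}=B_{ij}\sin\eta_{ij}-p^{nom}_{ij}$,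 $(i,j)\in E$. With $\zeta_j=[-\omega_j\ \ p^c_j]^T$, the scalars $p^M_j,d^c_j,d^u_j$ are generated by subsystems (S1) $\dot x^{M,j}=f^{M,j}(x^{M,j},\zeta_j)$, $p^M_j=g^{M,j}(x^{M,j},\zeta_j)$, $j\in G$; (S2) $\dot x^{c,j}=f^{c,j}(x^{c,j},\zeta_j)$, $d^c_j=g^{c,j}(x^{c,j},\zeta_j)$, $j\in N$; (S3) $\dot x^{u,j}=f^{u,j}(x^{u,j},-\omega_j)$, $-d^u_j=g^{u,j}(x^{u,j},-\omega_j)$, $j\in N$. $k_{p^M_j}$ and $k_{d^c_j}$ are the static input-output maps of (S1) and (S2), from $\zeta_j$ to $p^M_j$ and $d^c_j$. Net supply: $s_j=p^M_j-d^c_j$ for $j\in G$, $s_j=-d^c_j$ for $j\in L$. Power command. $(N,\tilde E)$ is a connected, arbitrarily directed communication graph, $\gamma_j,\gamma_{ij}>0$ constants: (P1) $\gamma_{ij}\dot\psi_{ij}=p^c_i-p^c_j$, $(i,j)\in\tilde E$; (P2) $\gamma_j\dot p^c_j=-(s_j-p^L_j)-\sum_{k:(j,k)\in\tilde E}\psi_{jk}+\sum_{i:(i,j)\in\tilde E}\psi_{ij}$, $j\in N$. Equilibrium: a point $\beta^*=(\eta^*,\psi^*,\omega^*,x^{M,*},x^{c,*},x^{u,*},p^{c,*})$ at which all time derivatives in the system vanish (and (N3) holds); $p^{M,*},d^{c,*}$ denote the corresponding values of $p^M,d^c$. At least one equilibrium is assumed to exist. OSLC problem: minimize $\sum_{j\in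 G}C_j(p^M_j)+\sum_{j\in N}C_{dj}(d^c_j)$ over $(p^M,d^c)$ subject to $\sum_{j\in G}p^M_j=\sum_{j\in N}(d^c_j+p^L_j)$, $p^{M,min}_j\le p^M_j\le p^{M,max}_j$ ($j\in G$), $d^{c,min}_j\le d^c_j\le d^{c,max}_j$ ($j\in N$), with given bounds. $(C_j')^{-1}$, $(C_{dj}')^{-1}$ are inverses of the (strictly increasing) derivatives, and the displayed formulas in the claim are understood to be well defined. *)

(* Defs.v *)
From HB Require Import structures.
From mathcomp Require Import all_boot all_order all_algebra.
From mathcomp Require Import all_classical all_reals all_analysis.

Set Implicit Arguments.
Unset Strict Implicit.
Unset Printing Implicit Defensive.

Import Order.TTheory GRing.Theory Num.Theory.
Import numFieldNormedType.Exports.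

Local Open Scope classical_set_scope.
Local Open Scope ring_scope.

Section subsystems.
Context {R : realType}.

(* Solutions of x' = v(x) on [0, T[; the interval need not be maximal. *)
Definition solution_on n (v : 'cV[R]_n -> 'cV[R]_n) (T : R) (x : R -> 'cV[R]_n)
  : Prop :=
  {within `[0, T[, continuous x} /\
  forall t : R, 0 < t < T -> is_derive t 1 x (v (x t)).

(* Quantifying over every existence interval makes stability exclude
   finite-time escape, so that [locally_attractive], which only mentions global
   solutions, cannot hold vacuously for a stable equilibrium of a locally
   Lipschitz field. *)
Definition lyapunov_stable n (v : 'cV[R]_n -> 'cV[R]_n) (xe : 'cV[R]_n) : Prop :=
  forall eps : R, 0 < eps -> exists2 delta : R, 0 < delta &
    forall (T : R) (x : R -> 'cV[R]_n), solution_on v T x ->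
      `|x 0 - xe| < delta -> forall t, 0 <= t < T -> `|x t - xe| < eps.

Definition locally_attractive n (v : 'cV[R]_n -> 'cV[R]_n) (xe : 'cV[R]_n)
  : Prop :=
  exists2 delta : R, 0 < delta &
    forall x : R -> 'cV[R]_n, (forall T, solution_on v T x) ->
      `|x 0 - xe| < delta -> x t @[t --> +oo] --> xe.

Definition locally_asymptotically_stable n (v : 'cV[R]_n -> 'cV[R]_n)
    (xe : 'cV[R]_n) : Prop :=
  lyapunov_stable v xe /\ locally_attractive v xe.

(* x' = sub_rhs (x, u), y = sub_out (x, u), with a scalar output y. *)
Record subsystem (m : nat) := Subsystem {
  sub_dim : nat;
  sub_rhs : 'cV[R]_sub_dim * 'cV[R]_m -> 'cV[R]_sub_dim;
  sub_out : 'cV[R]_sub_dim * 'cV[R]_m -> R;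
  sub_rhs_lipschitz : [locally [lipschitz sub_rhs z | z in setT]];
  sub_out_continuous : continuous sub_out;
  sub_equilibrium : forall u, exists! x, sub_rhs (x, u) = 0;
  sub_stable : forall u x, sub_rhs (x, u) = 0 ->
    locally_asymptotically_stable (fun y => sub_rhs (y, u)) x }.

(* [get] returns the unique equilibrium provided by [sub_equilibrium]. *)
Definition static_state m (S : subsystem m) (u : 'cV[R]_m)
  : 'cV[R]_(sub_dim S) :=
  get [set x | sub_rhs (x, u) = 0].

Definition static_output m (S : subsystem m) (u : 'cV[R]_m) : R :=
  sub_out (static_state S u, u).

(* (a, b) as an element of R^2 *)
Definition vec2 (a b : R) : 'cV[R]_2 := \col_(i < 2) (if i == 0 then a else b).

End subsystems.

Arguments subsystem R m : clear implicits.

Definition undirected (N : finType) (E : rel N) : rel N :=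
  [rel i j | E i j || E j i].

(* Antisymmetry also excludes self-loops; connectedness ignores orientations. *)
Definition oriented_connected_graph (N : finType) (E : rel N) : Prop :=
  (forall i j, E i j -> ~~ E j i) /\ (forall i j, connect (undirected E) i j).

(* The buses without inertia are those outside [gen].  Data indexed by [gen]
   (resp. by the lines) are total functions whose values at other indices are
   never used. *)
Record power_network (R : realType) (N : finType) := PowerNetwork {
  gen : {set N};
  line : rel N;
  line_graph : oriented_connected_graph line;
  inertia : N -> R;
  inertia_gt0 : forall j, j \in gen -> 0 < inertia j;
  suscept : N -> N -> R;
  suscept_gt0 : forall i j, line i j -> 0 < suscept i j;
  pnom : N -> N -> R;
  pL : N -> R;
  sysM : N -> subsystem R 2;
  sysc : N -> subsystem R 2;
  sysu : N -> subsystem R 1;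
  comm : rel N;
  comm_graph : oriented_connected_graph comm;
  gam : N -> R;
  gam_gt0 : forall j, 0 < gam j;
  gamE : N -> N -> R;
  gamE_gt0 : forall i j, comm i j -> 0 < gamE i j }.

Record state (R : realType) (N : finType) (S : power_network R N) := State {
  eta : N -> N -> R;
  psi : N -> N -> R;
  omega : N -> R;
  xM : forall j, 'cV[R]_(sub_dim (sysM S j));
  xc : forall j, 'cV[R]_(sub_dim (sysc S j));
  xu : forall j, 'cV[R]_(sub_dim (sysu S j));
  pc : N -> R }.

Section dynamics.
Context {R : realType} {N : finType} (S : power_network R N) (b : state S).

Definition zeta (j : N) : 'cV[R]_2 := vec2 (- omega b j) (pc b j).
Definition freq_input (j : N) : 'cV[R]_1 := const_mx (- omega b j).

Definition pM (j : N) : R := sub_out (xM b j, zeta j).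
Definition dc (j : N) : R := sub_out (xc b j, zeta j).
(* the output of the third kind of subsystem is - d^u *)
Definition du (j : N) : R := - sub_out (xu b j, freq_input j).

Definition flow (i j : N) : R := suscept S i j * sin (eta b i j) - pnom S i j.

(* p^M - d^c at buses with inertia, - d^c at the others *)
Definition supply (j : N) : R := if j \in gen S then pM j - dc j else - dc j.

Definition eta_dot (i j : N) : R := omega b i - omega b j.

Definition omega_dot (j : N) : R := (inertia S j)^-1 *
  (- pL S j + pM j - (dc j + du j)
   - (\sum_(k | line S j k) flow j k) + \sum_(i | line S i j) flow i j).

Definition psi_dot (i j : N) : R := (gamE S i j)^-1 * (pc b i - pc b j).

Definition pc_dot (j : N) : R := (gam S j)^-1 *
  (- (supply j - pL S j)
   - (\sum_(k | comm S j k) psi b j k) + \sum_(i | comm S i j) psi b i j).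

Definition balanced (j : N) : Prop :=
  0 = - pL S j - (dc j + du j)
      - (\sum_(k | line S j k) flow j k) + \sum_(i | line S i j) flow i j.

Definition angle_consistent : Prop :=
  exists theta : N -> R, forall i j, line S i j -> eta b i j = theta i - theta j.

Record is_equilibrium : Prop := IsEquilibrium {
  eq_angle : angle_consistent;
  eq_eta : forall i j, line S i j -> eta_dot i j = 0;
  eq_omega : forall j, j \in gen S -> omega_dot j = 0;
  eq_balance : forall j, j \notin gen S -> balanced j;
  eq_xM : forall j, j \in gen S -> sub_rhs (xM b j, zeta j) = 0;
  eq_xc : forall j, sub_rhs (xc b j, zeta j) = 0;
  eq_xu : forall j, sub_rhs (xu b j, freq_input j) = 0;
  eq_psi : forall i j, comm S i j -> psi_dot i j = 0;
  eq_pc : forall j, pc_dot j = 0 }.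

End dynamics.

Definition continuously_differentiable (R : realType) (h : R -> R) : Prop :=
  (forall x, derivable h x 1) /\ continuous (derive1 h).

Definition strictly_convex (R : realType) (h : R -> R) : Prop :=
  forall x y t : R, x != y -> 0 < t < 1 ->
    h (t * x + (1 - t) * y) < t * h x + (1 - t) * h y.

(* (h')^-1; meaningful on the range of h'. *)
Definition deriv_inv (R : realType) (h : R -> R) : R -> R :=
  pinv [set: R] (derive1 h).

(* [q]_a^b *)
Definition clip (R : realType) (a b q : R) : R := Num.max (Num.min q b) a.

Record oslc_data (R : realType) (N : finType) := OslcData {
  costM : N -> R -> R;
  costd : N -> R -> R;
  pMmin : N -> R;
  pMmax : N -> R;
  dcmin : N -> R;
  dcmax : N -> R }.

Section oslc.
Context {R : realType} {N : finType} (S : power_network R N)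
  (P : oslc_data R N).
Implicit Types p d : N -> R.

(* The decision variable p^M is indexed by the buses with inertia: values of
   [p] outside [gen S] are irrelevant here and below. *)
Definition oslc_cost p d : R :=
  \sum_(j in gen S) costM P j (p j) + \sum_j costd P j (d j).

Definition oslc_feasible p d : Prop :=
  [/\ \sum_(j in gen S) p j = \sum_j (d j + pL S j),
      forall j, j \in gen S -> pMmin P j <= p j <= pMmax P j &
      forall j, dcmin P j <= d j <= dcmax P j].

Definition oslc_optimal p d : Prop :=
  oslc_feasible p d /\
  forall p' d', oslc_feasible p' d' -> oslc_cost p d <= oslc_cost p' d'.

End oslc.

(* Main.v *)
Require Import Defs.
From mathcomp Require Import all_boot all_order all_algebra.
From mathcomp Require Import all_classical all_reals all_analysis.
From mathcomp Require Import ring lra.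
Import Order.TTheory GRing.Theory Num.Theory.
Import numFieldNormedType.Exports.
Local Open Scope classical_set_scope.
Local Open Scope ring_scope.

(* At an equilibrium all frequencies agree (the line graph is connected) and
   all power commands agree (the communication graph is connected), so every
   bus receives the same input z.  Summing the power command equations cancels
   psi and yields the power balance constraint.  The common value f z is a
   Lagrange multiplier for this constraint: clipping (C')^-1 (f z) to its
   bounds minimizes the convex function q |-> C q - f z * q over these
   bounds. *)

(** For [t] in []0, 1[], convexity along the segment bounds the difference quotient at [x] in
    direction [y - x] by [h y - h x]; the bound survives the limit as [t] decreases to 0. *)
Lemma convex_tangent_le (R : realType) (h : R -> R) (x y : R) :
  strictly_convex h -> derivable h x 1 ->
  h x + derive1 h x * (y - x) <= h y.
Proof.
move=> hconv /derivable1_diffP hd.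
have [->|yx] := eqVneq y x; first by rewrite subrr mulr0 addr0.
have /cvg_dnbhs_at_right := @diff_derivable _ _ _ h x (y - x) hd.
have <- : 'D_(y - x) h x = derive1 h x * (y - x).
  rewrite deriveE // deriv1E; last exact/derivable1_diffP.
  by rewrite mulrC.
move=> hlim; rewrite -lerBrDl.
apply: cvgr_to_le hlim _; near=> t.
have t0 : 0 < t by near: t; exact: nbhs_right_gt.
have t1 : t < 1 by near: t; exact: nbhs_right_lt.
have := hconv y x t yx.
rewrite t0 t1 => /(_ isT)/ltW.
have -> : t * y + (1 - t) * x = t *: (y - x) + x by rewrite /GRing.scale/=; ring.
move=> le_chord; rewrite /= /GRing.scale /= mulrC ler_pdivrMr //.
by move: le_chord; rewrite /GRing.scale /=; lra.
Unshelve. all: by end_near. Qed.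

Lemma clip_itv (R : realType) (a b q : R) : a <= b -> a <= clip a b q <= b.
Proof. by move=> ab; rewrite /clip le_max ge_max lexx orbT ge_min lexx orbT. Qed.

(** First-order optimality over [[a, b]]: at the clipped point either the slope of [h] is [l], or a
    bound is active and the slope differs from [l] in the direction that favours every feasible
    [y]. *)
Lemma clip_deriv_inv_tangent (R : realType) (h : R -> R) (a b l y : R) :
  strictly_convex h -> (forall x, derivable h x 1) -> range (derive1 h) l ->
  a <= y <= b ->
  h (clip a b (deriv_inv h l)) + l * (y - clip a b (deriv_inv h l)) <= h y.
Proof.
move=> hconv hd hl /andP[ay yb].
have ab := le_trans ay yb.
have hql : derive1 h (deriv_inv h l) = l by rewrite /deriv_inv pinvK ?inE.
set q := deriv_inv h l in hql *.
have tq x : h q + l * (x - q) <= h x by rewrite -hql; exact: convex_tangent_le.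
have tangent u v : h u + derive1 h u * (v - u) <= h v by exact: convex_tangent_le.
rewrite /clip; have [qb|bq] := leP q b.
  have [aq|qa] := leP a q; first exact: tq.
  (* The tangents at [q] and [a], each evaluated at the other point, force the slope at [a] to be at
     least [l]; then [a <= y] concludes. The case [b < q] is symmetric. *)
  have := tangent a y; have := tangent a q; have := tq a; nra.
rewrite (max_idPl ab).
have := tangent b y; have := tangent b q; have := tq b; nra.
Qed.

Lemma connect_undirected_eq (N : finType) (T : eqType) (E : rel N) (h : N -> T) :
  (forall i j, connect (undirected E) i j) ->
  (forall i j, E i j -> h i = h j) -> forall i j, h i = h j.
Proof.
move=> Econn hE i j.
(* The level set of [h] through [i] is closed under adjacency, so connectedness makes it
   everything. *)
have hcl : fingraph.closed (undirected E) [pred k | h i == h k].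
  by move=> k l /= /orP[] /hE; rewrite !inE => ->.
by have := closed_connect hcl (Econn i j); rewrite !inE eqxx => /esym/eqP.
Qed.

(** Each edge contributes once at its tail and once at its head. *)
Lemma sum_outflow_inflow (V : nmodType) (N : finType) (E : rel N)
    (w : N -> N -> V) :
  \sum_j \sum_(k | E j k) w j k = \sum_j \sum_(i | E i j) w i j.
Proof. by rewrite (exchange_big_dep predT). Qed.

(** By uniqueness, the equilibrium selected by [get] can only be [x]. *)
Lemma static_output_equilibrium (R : realType) m (S : subsystem R m)
    (u : 'cV[R]_m) (x : 'cV[R]_(sub_dim S)) :
  sub_rhs (x, u) = 0 -> static_output S u = sub_out (x, u).
Proof.
move=> x_eq; have [x0 [x0_eq x0_uniq]] := sub_equilibrium S u.
rewrite /static_output /static_state; case: xgetP => [y _ /= y_eq|/(_ x)//].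
by rewrite -(x0_uniq _ y_eq) -(x0_uniq _ x_eq).
Qed.

Lemma equilibrium_zeta_const (R : realType) (N : finType)
    (S : power_network R N) (b : state S) :
  is_equilibrium b -> exists z, forall j, zeta b j = z.
Proof.
move=> b_eq.
have omegaE : forall i j, omega b i = omega b j.
  apply: (connect_undirected_eq _ _ _ _ (line_graph S).2) => i j Eij.
  exact/subr0_eq/(eq_eta b_eq).
have pcE : forall i j, pc b i = pc b j.
  apply: (connect_undirected_eq _ _ _ _ (comm_graph S).2) => i j Eij.
  have /eqP := eq_psi b_eq Eij.
  by rewrite mulf_eq0 invr_eq0 gt_eqF ?gamE_gt0 //= subr_eq0 => /eqP.
(* A reference bus supplies the witness; if there is no bus, any value such as 0 will do. *)
case: (pickP (fun _ : N => true)) => [i _|N0]; last by exists 0 => j; have := N0 j.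
by exists (zeta b i) => j; rewrite /zeta (omegaE j i) (pcE j i).
Qed.

Lemma equilibrium_power_balance (R : realType) (N : finType)
    (S : power_network R N) (b : state S) :
  is_equilibrium b -> \sum_(j in gen S) pM b j = \sum_j (dc b j + pL S j).
Proof.
move=> b_eq.
have pc0 j : supply b j - pL S j =
    \sum_(i | comm S i j) psi b i j - \sum_(k | comm S j k) psi b j k.
  have /eqP := eq_pc b_eq j.
  rewrite mulf_eq0 invr_eq0 gt_eqF ?gam_gt0 //= => /eqP; lra.
have : \sum_j (supply b j - pL S j) = 0.
  by under eq_bigr do rewrite pc0; rewrite sumrB sum_outflow_inflow subrr.
(* Extending generation by 0 outside [gen S] turns the sum over all buses into one over [gen S]. *)
have supplyE j : supply b j = (if j \in gen S then pM b j else 0) - dc b j.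
  by rewrite /supply; case: ifP => _ //; rewrite sub0r.
under eq_bigr do rewrite supplyE.
rewrite !sumrB -big_mkcond big_split /=; lra.
Qed.

Theorem theorem1 (R : realType) (N : finType) (S : power_network R N)
    (P : oslc_data R N) (f : 'cV[R]_2 -> R)
    (costM_C1 : forall j, j \in gen S -> continuously_differentiable (costM P j))
    (costM_convex : forall j, j \in gen S -> strictly_convex (costM P j))
    (costd_C1 : forall j, continuously_differentiable (costd P j))
    (costd_convex : forall j, strictly_convex (costd P j))
    (pM_bounds : forall j, j \in gen S -> pMmin P j <= pMmax P j)
    (dc_bounds : forall j, dcmin P j <= dcmax P j)
    (f_surj : set_surj [set: 'cV[R]_2] [set: R] f)
    (f_incr : forall w p q : R, p < q -> f (vec2 w p) < f (vec2 w q))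
    (costM_inv_def : forall j z, j \in gen S -> range (derive1 (costM P j)) (f z))
    (costd_inv_def : forall j z, range (derive1 (costd P j)) (- f z))
    (kM_eq : forall j z, j \in gen S ->
       static_output (sysM S j) z
         = clip (pMmin P j) (pMmax P j) (deriv_inv (costM P j) (f z)))
    (kd_eq : forall j z,
       static_output (sysc S j) z
         = clip (dcmin P j) (dcmax P j) (deriv_inv (costd P j) (- f z)))
    (equilibrium_exists : exists b0 : state S, is_equilibrium b0)
    (b : state S) (b_eq : is_equilibrium b) :
  oslc_optimal S P (pM b) (dc b).
Proof.
have [z zE] := equilibrium_zeta_const _ _ _ _ b_eq.
have pME j : j \in gen S ->
    pM b j = clip (pMmin P j) (pMmax P j) (deriv_inv (costM P j) (f z)).
  move=> jG; rewrite -kM_eq // -(zE j).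
  exact/esym/static_output_equilibrium/(eq_xM b_eq).
have dcE j : dc b j = clip (dcmin P j) (dcmax P j) (deriv_inv (costd P j) (- f z)).
  by rewrite -kd_eq -(zE j); exact/esym/static_output_equilibrium/(eq_xc b_eq).
have balance := equilibrium_power_balance _ _ _ _ b_eq.
split=> [|p' d' [balance' p'_itv d'_itv]].
  split=> // [j jG|j]; first by rewrite pME // clip_itv ?pM_bounds.
  by rewrite dcE clip_itv.
have costM_le j : j \in gen S ->
    costM P j (pM b j) + f z * (p' j - pM b j) <= costM P j (p' j).
  move=> jG; rewrite pME //; have [C1 _] := costM_C1 _ jG.
  by apply: clip_deriv_inv_tangent; [exact: costM_convex| |exact: costM_inv_def|exact: p'_itv].
(* Demand enters the balance on the opposite side from generation, hence the multiplier [- f z]. *)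
have costd_le j :
    costd P j (dc b j) + - f z * (d' j - dc b j) <= costd P j (d' j).
  rewrite dcE; have [C1 _] := costd_C1 j.
  exact: clip_deriv_inv_tangent.
(* Once the bounds are summed, the multiplier terms add up to [f z] times the difference of the two
   net supplies; both equal the sum of [pL S], so these terms vanish and the remaining inequality is
   an equality. *)
rewrite /oslc_cost; apply: le_trans (lerD (ler_sum _ costM_le) (ler_sum _ (fun j _ => costd_le j))).
rewrite !big_split /= -!mulr_sumr !sumrB.
move: balance balance'; rewrite !big_split /=.
set s1 := \sum_(_ in _) pM b _; set s2 := \sum_(_ in _) p' _ => -> ->.
rewrite le_eqVlt; apply/orP; left; apply/eqP; ring.
Qed.
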